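(* Let $\frac{r}{s}$ be a rational number greater than $1$ and let $\frac{\mathcal{R}}{\mathcal{S}}=\left[\frac{r}{s}\right]_q$ be its $q$-deformation. Then $$\mathcal{R}=\sum_{\pi:\frac{r}{s}\to\frac10}\mathrm{wt}(\pi),\qquad \mathcal{S}=\sum_{\pi:\frac{r}{s}\to\frac11}\mathrm{wt}(\pi),$$ where the sums run over all oriented paths $\pi$ in the weighted oriented Farey tessellation from $\frac rs$ to $\frac10$, respectively from $\frac rs$ to $\frac11$, and $\mathrm{wt}(\pi)$ is the weight of $\pi$.
   Context: Rationals are written in irreducible form $\frac rs$ with nonnegative coprime $r,s$, and one adds the point $\frac10$ (infinity). Farey tessellation: its vertices are the elements of $\mathbb{Q}_{>0}\cup\{\frac01,\frac10\}$, ordered on a horizontal segment from $\frac01$ (left end) to $\frac10$ (right end); two vertices $\frac rs,\frac{r'}{s'}$ are joined by an edge (a half-circle) whenever $rs'-r's=\pm1$. The triangles are exactly those with vertices $\frac rs<\frac{r+r'}{s+s'}<\frac{r'}{s'}$ where $\frac rs,\frac{r'}{s'}$ are joined by an edge; $\frac{r+r'}{s+s'}$ is the median vertex of the triangle. Every vertex other than $\frac01,\frac10$ is the median vertex of a unique triangle. Weights and $q$-rationals: every edge except $\{\frac01,\frac10\}$ receives a weight (a power of $q$) and every vertex $\frac rs$ receives a pair $(\mathcal R,\mathcal S)$ of polynomials in $q$, recursively. Start: $\frac01$ has pair $(0,1)$, $\frac10$ has pair $(1,0)$, $\frac11$ has pair $(1,1)$, and the edges $\{\frac01,\frac11\}$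 and $\{\frac11,\frac10\}$ have weight $1$. Local rule: if $\frac rs<\frac{r'}{s'}$ are joined by an edge of weight $q^{d-1}$ and have pairs $(\mathcal R,\mathcal S)$ and $(\mathcal R',\mathcal S')$, then the median vertex $\frac{r+r'}{s+s'}$ has pair $(\mathcal R+q^d\mathcal R',\ \mathcal S+q^d\mathcal S')$, the edge from it to $\frac rs$ has weight $1$, and the edge from it to $\frac{r'}{s'}$ has weight $q^d$. The $q$-deformation of $\frac rs$ is $\left[\frac rs\right]_q=\frac{\mathcal R}{\mathcal S}$, with numerator $\mathcal R$ and denominator $\mathcal S$ given by this recursion. Orientation: every edge other than $\{\frac01,\frac10\}$ is oriented so that in each triangle the two edges at the median vertex go out of the median vertex; so each vertex other than $\frac01,\frac10$ has exactly two outgoing edges, one to the left and one to the right. Path: a path $\pi:\frac{r_0}{s_0}\to\frac{r_n}{s_n}$ is a sequence $\frac{r_0}{s_0}\xrightarrow{\rho_1}\frac{r_1}{s_1}\xrightarrow{\rho_2}\cdots\xrightarrow{\rho_n}\frac{r_n}{s_n}$ where $\rho_i$ is an edge oriented from $\frac{r_{i-1}}{s_{i-1}}$ to $\frac{r_i}{s_i}$. Its weight is $\mathrm{wt}(\pi)=\mathrm{wt}(\rho_1)\cdots\mathrm{wt}(\rho_n)$, where $\mathrm{wt}(\rho)$ is the weight of the edge $\rho$. *)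

(* Defs.v *)
(* MathComp, with the classical sets of MathComp-Analysis for the sums over
   sets of paths.  The variable q is 'X in {poly int}. *)
From HB Require Import structures.
From mathcomp Require Import all_boot all_order all_algebra.
From mathcomp Require Import boolp classical_sets functions cardinality fsbigop.
From mathcomp Require Import zify.

Set Implicit Arguments.
Unset Strict Implicit.
Unset Printing Implicit Defensive.

Import GRing.Theory.
Local Open Scope ring_scope.

(* (r, s) stands for r/s; the vertices of the Farey tessellation are the pairs
   with coprime r s, which include 0/1 and 1/0.  The endpoints of a Farey edge
   satisfy this automatically. *)
Definition vertex := (nat * nat)%type.

Definition farey_lt (x y : vertex) : bool := (x.1 * y.2 < y.1 * x.2)%N.

Definition farey_edge (x y : vertex) : bool :=
  (x.1 * y.2 == (y.1 * x.2).+1)%N || (y.1 * x.2 == (x.1 * y.2).+1)%N.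

Definition median (x y : vertex) : vertex := (x.1 + y.1, x.2 + y.2)%N.

(* u < median u v < v is a triangle of the tessellation. *)
Definition farey_triangle (u v : vertex) : bool :=
  farey_edge u v && farey_lt u v.

(* The edge between x and y is oriented from x to y. *)
Definition arrow (x y : vertex) : Prop :=
  exists u v : vertex,
    [/\ farey_triangle u v, x = median u v & y = u \/ y = v].

(* A path from x to y is represented by the sequence of its vertices without
   the first one, x. *)
Definition farey_paths (x y : vertex) : set (seq vertex) :=
  [set p | path (fun a b => `[< arrow a b >]) x p /\ last x p = y].

(* A triangle u < median u v < v together with the d such that {u, v} has
   weight q^(d-1), and the pairs (numerator, denominator) of u and v. *)
Record qtriangle := QTriangle {
  lft : vertex;
  rgt : vertex;
  deg : nat;
  lpair : {poly int} * {poly int};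
  rpair : {poly int} * {poly int} }.

Definition tmed (t : qtriangle) : vertex := median (lft t) (rgt t).

Definition mpair (t : qtriangle) : {poly int} * {poly int} :=
  ((lpair t).1 + 'X^(deg t) * (rpair t).1,
   (lpair t).2 + 'X^(deg t) * (rpair t).2).

Definition lchild (t : qtriangle) : qtriangle :=
  QTriangle (lft t) (tmed t) 1 (lpair t) (mpair t).

Definition rchild (t : qtriangle) : qtriangle :=
  QTriangle (tmed t) (rgt t) (deg t).+1 (mpair t) (rpair t).

(* The edge {0/1, 1/0} has no weight; with d = 0 the local rule yields the
   prescribed pair of 1/1 and weights of {0/1, 1/1} and {1/1, 1/0}. *)
Definition troot : qtriangle := QTriangle (0, 1)%N (1, 0)%N 0 (0, 1) (1, 0).

Fixpoint descend (n : nat) (t : qtriangle) (x : vertex) : qtriangle :=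
  if n is n'.+1 then
    if x == tmed t then t
    else descend n' (if farey_lt x (tmed t) then lchild t else rchild t) x
  else t.

(* The triangle with median vertex x, for x other than 0/1 and 1/0: it is at
   depth less than x.1 + x.2. *)
Definition triangle_of (x : vertex) : qtriangle :=
  descend (x.1 + x.2)%N troot x.

Definition qpair (x : vertex) : {poly int} * {poly int} :=
  if x == (0, 1)%N then (0, 1)
  else if x == (1, 0)%N then (1, 0)
  else mpair (triangle_of x).

Definition qnum (x : vertex) : {poly int} := (qpair x).1.
Definition qden (x : vertex) : {poly int} := (qpair x).2.

(* Weight of the edge from the median vertex x of a triangle to y. *)
Definition out_wt (x y : vertex) : {poly int} :=
  if y == lft (triangle_of x) then 1 else 'X^(deg (triangle_of x)).

(* Weight of the unoriented edge {x, y}: its source is the endpoint with the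
   larger r + s, and only {0/1, 1/0} has a tie. *)
Definition edge_wt (x y : vertex) : {poly int} :=
  if (x.1 + x.2 < y.1 + y.2)%N then out_wt y x
  else if (y.1 + y.2 < x.1 + x.2)%N then out_wt x y
  else 0.

Fixpoint path_wt (x : vertex) (p : seq vertex) : {poly int} :=
  if p is y :: p' then edge_wt x y * path_wt y p' else 1.

(* The recursion defining the weights of the edges and the q-rationals.  The
   lemma farey_q_weighting below shows that edge_wt and qpair satisfy it. *)
Record q_weighting (wt : vertex -> vertex -> {poly int})
    (qp : vertex -> {poly int} * {poly int}) : Prop := QWeighting {
  wt_sym : forall x y, wt x y = wt y x;
  wt_pow : forall u v, farey_triangle u v -> (u, v) <> ((0, 1), (1, 0))%N ->
    exists d, wt u v = 'X^d;
  qp_01 : qp (0, 1)%N = (0, 1);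
  qp_10 : qp (1, 0)%N = (1, 0);
  qp_11 : qp (1, 1)%N = (1, 1);
  wt_01_11 : wt (0, 1)%N (1, 1)%N = 1;
  wt_11_10 : wt (1, 1)%N (1, 0)%N = 1;
  local_rule : forall u v d, farey_triangle u v ->
    (u, v) <> ((0, 1), (1, 0))%N -> (0 < d)%N -> wt u v = 'X^(d.-1) ->
    [/\ qp (median u v) = ((qp u).1 + 'X^d * (qp v).1,
                           (qp u).2 + 'X^d * (qp v).2),
        wt (median u v) u = 1
      & wt (median u v) v = 'X^d] }.

Inductive reached : qtriangle -> Prop :=
  | reached_root : reached troot
  | reached_l t : reached t -> reached (lchild t)
  | reached_r t : reached t -> reached (rchild t).

Lemma farey_triangleE u v :
  farey_triangle u v = (v.1 * u.2 == (u.1 * v.2).+1)%N.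
Proof. by rewrite /farey_triangle /farey_edge /farey_lt; apply/idP/idP; lia. Qed.

Lemma farey_triangle_reached u v : farey_triangle u v ->
  exists t, [/\ reached t, lft t = u & rgt t = v].
Proof.
have [n] := ubnP (u.1 + u.2 + v.1 + v.2)%N.
elim: n u v => // n IH [a b] [c d] /= ltn.
rewrite farey_triangleE /= => /eqP E.
have [/andP[/eqP a0 /eqP d0]|nz] := boolP ((a == 0) && (d == 0))%N.
  move: E; rewrite a0 d0 mul0n => /eqP; rewrite muln_eq1 => /andP[/eqP-> /eqP->].
  by exists troot; split=> //; exact: reached_root.
have [/andP[ca db]|nle] := boolP ((c <= a) && (d <= b))%N.
  have [||t [rt lt rgtt]] := IH (a - c, b - d)%N (c, d).
  - by rewrite /=; nia.
  - by rewrite farey_triangleE /=; nia.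
  exists (rchild t); split; [exact: reached_r| |by []].
  by rewrite /= /tmed lt rgtt /median /= !subnK.
have le : ((a <= c) && (b <= d))%N by nia.
have /andP[ac bd] := le.
have [||t [rt lt rgtt]] := IH (a, b) (c - a, d - b)%N.
- by rewrite /=; nia.
- by rewrite farey_triangleE /=; nia.
exists (lchild t); split; [exact: reached_l|by []|].
by rewrite /= /tmed lt rgtt /median /= !subnKC.
Qed.

Lemma reached_triangle t : reached t -> farey_triangle (lft t) (rgt t).
Proof.
elim=> [//|{}t rt|{}t rt]; rewrite !farey_triangleE /tmed /median /=;
  by move=> /eqP h; apply/eqP; nia.
Qed.

Lemma descend_reached t : reached t ->
  exists k, (k.+1 < (tmed t).1 + (tmed t).2)%N /\
  forall n x, farey_lt (lft t) x -> farey_lt x (rgt t) ->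
    descend (n + k) troot x = descend n t x.
Proof.
elim=> [|{}t rt [k [ltk IH]]|{}t rt [k [ltk IH]]].
- by exists 0%N; split=> // n x _ _; rewrite addn0.
- have := reached_triangle rt; rewrite farey_triangleE => /eqP E.
  exists k.+1; split; first by move: ltk; rewrite /tmed /median /=; nia.
  move=> n x /= h1 h2; rewrite addnS -addSn IH //=.
    by rewrite h2; case: eqP => // e; move: h2; rewrite e /farey_lt ltnn.
  move: h1 h2 E; rewrite /farey_lt /tmed /median /=.
  move: (lft t) (rgt t) x => [a b] [c d] [e f] /=.
  by clear; nia.
- have := reached_triangle rt; rewrite farey_triangleE => /eqP E.
  exists k.+1; split; first by move: ltk; rewrite /tmed /median /=; nia.
  move=> n x /= h1 h2; rewrite addnS -addSn IH //=.
    case: eqP => [e|_]; first by move: h1; rewrite e /farey_lt ltnn.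
    by rewrite ifN //; move: h1; rewrite /farey_lt; lia.
  move: h1 h2 E; rewrite /farey_lt /tmed /median /=.
  move: (lft t) (rgt t) x => [a b] [c d] [e f] /=.
  by clear; nia.
Qed.

Lemma triangle_of_tmed t : reached t -> triangle_of (tmed t) = t.
Proof.
move=> rt; have [k [ltk dk]] := descend_reached rt.
have := reached_triangle rt; rewrite farey_triangleE => /eqP E.
rewrite /triangle_of -(subnK (ltnW (ltnW ltk))) dk.
- by case: (_ - k)%N => //= m; rewrite eqxx.
- by move: E; rewrite /farey_lt /tmed /median /=; nia.
- by move: E; rewrite /farey_lt /tmed /median /=; nia.
Qed.

Lemma qpair_tmed t : reached t -> qpair (tmed t) = mpair t.
Proof.
move=> rt; have := reached_triangle rt; rewrite farey_triangleE => /eqP E.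
rewrite /qpair ifN; last by rewrite /tmed /median xpair_eqE; nia.
by rewrite ifN ?triangle_of_tmed //; rewrite /tmed /median xpair_eqE; nia.
Qed.

Lemma reached_pairs t : reached t ->
  qpair (lft t) = lpair t /\ qpair (rgt t) = rpair t.
Proof.
by elim=> [//|{}t rt [hl hr]|{}t rt [hl hr]]; rewrite /= qpair_tmed.
Qed.

Lemma edge_wtC x y : edge_wt x y = edge_wt y x.
Proof. by rewrite /edge_wt; case: ltngtP. Qed.

Lemma edge_wt_tmed t : reached t ->
  edge_wt (tmed t) (lft t) = 1 /\ edge_wt (tmed t) (rgt t) = 'X^(deg t).
Proof.
move=> rt; have := reached_triangle rt; rewrite farey_triangleE => /eqP E.
rewrite ![edge_wt (tmed t) _]edge_wtC /edge_wt !ifT ?/out_wt.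
- rewrite triangle_of_tmed // eqxx ifN //.
  by apply/eqP => e; move: E; rewrite e; lia.
- by rewrite /tmed /median /=; nia.
- by rewrite /tmed /median /=; nia.
Qed.

Lemma edge_wt_reached t : reached t ->
  t = troot \/ (0 < deg t)%N /\ edge_wt (lft t) (rgt t) = 'X^((deg t).-1).
Proof.
case=> [|{}t rt|{}t rt]; [by left|right; split=> //=|right; split=> //=].
- by rewrite edge_wtC (edge_wt_tmed rt).1.
- by rewrite (edge_wt_tmed rt).2.
Qed.

Lemma farey_q_weighting : q_weighting edge_wt qpair.
Proof.
have r0 := reached_root.
split=> //.
- exact: edge_wtC.
- move=> _ _ /farey_triangle_reached[t [rt <- <-]] ne.
  have [e|[_ ->]] := edge_wt_reached rt; last by eexists.
  by case: ne; rewrite e.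
- by rewrite (qpair_tmed r0) /mpair /= mulr1 mulr0 add0r addr0.
- move=> _ _ d /farey_triangle_reached[t [rt <- <-]] ne d0.
  have [e|[t0 ->]] := edge_wt_reached rt; first by case: ne; rewrite e.
  move=> /(congr1 (fun p : {poly int} => size p)).
  rewrite !size_polyXn => -[] e.
  have {e d0} -> : d = deg t by lia.
  have [-> ->] := reached_pairs rt.
  rewrite -/(tmed t) qpair_tmed //.
  by have [-> ->] := edge_wt_tmed rt.
Qed.

Lemma arrow_lt x y : arrow x y -> (y.1 <= x.1)%N /\ (y.2 <= x.2)%N /\ x <> y.
Proof.
move=> [u [v [+ -> yuv]]]; rewrite farey_triangleE => /eqP E.
case: x => _ _; case: u v E yuv => [a b] [c d] /= E [] -> /=;
  rewrite /median /=; do ?split; try lia; move=> -[]; nia.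
Qed.

(* Hence the sums over farey_paths x y are genuine finite sums. *)
Lemma finite_farey_paths x y : finite_set (farey_paths x y).
Proof.
have [n] := ubnP (x.1 + x.2)%N; elim: n x => // n IH x ltn.
set box := (`I_x.1.+1 `*` `I_x.2.+1 `&` [set z | arrow x z])%classic.
apply: (@sub_finite_set _ _
  ([set [::]] `|` \bigcup_(z in box) (cons z @` farey_paths z y))%classic).
  move=> [|z p] [/= hp hl]; [by left|right].
  move: hp => /andP[/asboolP xz hp].
  by exists z; [have [? [? _]] := arrow_lt xz|exists p].
rewrite finite_setU; split; first exact: finite_set1.
apply: bigcup_finite => [|z [_ xz]].
  by apply: finite_setIl; apply: finite_setX; apply: finite_II.
apply: finite_image; apply: IH.
have [h1 [h2 ne]] := arrow_lt xz.
case: x z ltn h1 h2 ne {xz box} => [a b] [c d] /= ltn h1 h2 ne.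
have [/eqP e|ne1] := boolP (c == a); have [/eqP e'|ne2] := boolP (d == b);
  subst; try by []; lia.
Qed.

(* Main.v *)
Require Import Defs.
From mathcomp Require Import all_boot all_order all_algebra.
From mathcomp Require Import boolp classical_sets functions cardinality fsbigop.
From mathcomp Require Import zify.

Set Implicit Arguments.
Unset Strict Implicit.
Unset Printing Implicit Defensive.

Import GRing.Theory.
Local Open Scope ring_scope.

(** The theorem holds because the two sides obey the same recursion along the
    tessellation.  An oriented path that leaves the median vertex m of a
    triangle u < m < v starts with one of the only two edges going out of m,
    of weights 1 and q^d, and goes on from u or from v.  Thus, for a target y
    other than m, the weighted count P(m, y) of the paths from m to y satisfies
    P(m, y) = P(u, y) + q^d P(v, y) ([path_sum_tmed]), which is the local rule
    for numerators and for denominators.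

    It remains to compare initial values.  Every edge lowers r + s, so from a
    vertex x that is not higher than y the only possible path to y is the empty
    one, when x = y ([path_sum_low]).  For the target 1/0 this gives the values
    0 at 0/1 and 1 at 1/0, which are the numerators, and the induction over
    triangles starts at the root.  For the target 1/1 it gives 1 at 1/1 and 0
    at 1/0, which are the denominators; at 0/1 the two sides differ, as its
    denominator is 1 and no path goes from 0/1 to 1/1.  But the triangle of a
    vertex greater than 1 has all its vertices at 1/1 or to the right of it
    ([reached_tmed_ge1]), so an induction over the triangles of that part never
    meets 0/1. *)

Lemma reached_rgt_lft t : reached t ->
  ((rgt t).1 * (lft t).2 = ((lft t).1 * (rgt t).2).+1)%N.
Proof. by move=> /reached_triangle; rewrite farey_triangleE => /eqP. Qed.

Definition path_sum (x y : vertex) : {poly int} :=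
  \sum_(p \in farey_paths x y) path_wt x p.

Definition height (x : vertex) : nat := (x.1 + x.2)%N.

Lemma arrow_height x y : arrow x y -> (height y < height x)%N.
Proof.
rewrite /height; case: x y => [a b] [c d] /arrow_lt /= [le1 [le2 ne]].
have [eca|nca] := eqVneq c a; last by lia.
have [edb|ndb] := eqVneq d b; last by lia.
by case: ne; rewrite eca edb.
Qed.

Lemma farey_path_height x p : path (fun a b => `[< arrow a b >]) x p ->
  (height (last x p) + size p <= height x)%N.
Proof.
elim: p x => [|z p IH] x /=; first by rewrite addn0.
by case/andP=> /asboolP /arrow_height xz /IH zp; lia.
Qed.

Lemma path_sum_low x y : (height x <= height y)%N ->
  path_sum x y = (x == y)%:R.
Proof.
move=> xy; rewrite /path_sum.
have nilP p : farey_paths x y p -> p = [::] /\ x = y.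
  case=> /farey_path_height hp lp; rewrite lp in hp.
  have /nilP p0 : nilp p by rewrite /nilp; lia.
  by move: lp; rewrite p0.
case: eqP => [exy|nxy].
  rewrite (_ : farey_paths x y = [set [::]]%classic) ?fsbig_set1 //.
  by apply/seteqP; split=> [p /nilP[] //|_ ->].
by rewrite fsbig1 // => p /nilP[].
Qed.

(** A vertex is the median of one triangle only, so its outgoing edges are the
    two that this triangle provides. *)
Lemma arrow_tmed t z : reached t ->
  arrow (tmed t) z <-> z = lft t \/ z = rgt t.
Proof.
move=> rt; split=> [[u [v [/farey_triangle_reached[t' [rt' <- <-]] e]]]|h].
  suff -> : t = t' by [].
  by rewrite -(triangle_of_tmed rt) -(triangle_of_tmed rt') e.
by exists (lft t), (rgt t); split=> //; exact: reached_triangle.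
Qed.

Lemma farey_paths_tmed t y : reached t -> tmed t != y ->
  farey_paths (tmed t) y =
    (cons (lft t) @` farey_paths (lft t) y `|`
     cons (rgt t) @` farey_paths (rgt t) y)%classic.
Proof.
move=> rt ny; apply/seteqP; split=> [[|z p] [/= hp lp]|].
- by rewrite lp eqxx in ny.
- by case/andP: hp => /asboolP /(arrow_tmed _ rt) [e|e] hp;
    [left|right]; exists p; rewrite -?e.
- move=> _ [[p [hp lp] <-]|[p [hp lp] <-]]; split=> //=;
    rewrite hp andbT; apply/asboolP/arrow_tmed => //; by [left|right].
Qed.

Lemma path_sum_cons x z y :
  \sum_(p \in (cons z @` farey_paths z y)%classic) path_wt x p =
  edge_wt x z * path_sum z y.
Proof.
rewrite fsbig_image => [|p p' _ _ []//].
by rewrite /path_sum mulr_fsumr.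
Qed.

Lemma path_sum_tmed t y : reached t -> tmed t != y ->
  path_sum (tmed t) y =
    path_sum (lft t) y + 'X^(deg t) * path_sum (rgt t) y.
Proof.
move=> rt ny; rewrite {1}/path_sum farey_paths_tmed // fsbigU0.
- have [wl wr] := edge_wt_tmed rt.
  by rewrite !path_sum_cons wl wr mul1r.
- by apply: finite_image; exact: finite_farey_paths.
- by apply: finite_image; exact: finite_farey_paths.
- move=> _ [[p _ <-] [p' _ [e _]]].
  by have := reached_rgt_lft rt; rewrite e; lia.
Qed.

Lemma qnum_tmed t : reached t ->
  qnum (tmed t) = qnum (lft t) + 'X^(deg t) * qnum (rgt t).
Proof.
by move=> rt; rewrite /qnum qpair_tmed //; have [-> ->] := reached_pairs rt.
Qed.

Lemma qden_tmed t : reached t ->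
  qden (tmed t) = qden (lft t) + 'X^(deg t) * qden (rgt t).
Proof.
by move=> rt; rewrite /qden qpair_tmed //; have [-> ->] := reached_pairs rt.
Qed.

Lemma path_sum_num_tmed t : reached t ->
    path_sum (lft t) (1, 0)%N = qnum (lft t) ->
    path_sum (rgt t) (1, 0)%N = qnum (rgt t) ->
  path_sum (tmed t) (1, 0)%N = qnum (tmed t).
Proof.
move=> rt el er; rewrite path_sum_tmed // ?qnum_tmed ?el ?er //.
apply/eqP; rewrite /tmed /median => -[e1 e2].
by have := reached_rgt_lft rt; nia.
Qed.

Lemma path_sum_num t : reached t ->
  path_sum (lft t) (1, 0)%N = qnum (lft t) /\
  path_sum (rgt t) (1, 0)%N = qnum (rgt t).
Proof.
elim=> [|{}t rt [el er]|{}t rt [el er]] /=.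
- by rewrite !path_sum_low.
- by split=> //; exact: path_sum_num_tmed.
- by split=> //; exact: path_sum_num_tmed.
Qed.

(** Only the root triangle has 1/1 strictly between its extreme vertices. *)
Lemma reached_tmed_ge1 t : reached t -> ((tmed t).2 <= (tmed t).1)%N ->
  tmed t = (1, 1)%N \/ ((lft t).2 <= (lft t).1)%N.
Proof.
move=> /reached_rgt_lft; rewrite /tmed /median /=.
move: (lft t) (rgt t) => [a b] [c d] /= E le.
have [|ltab] := leqP b a; [by right|left].
have [k ek] : exists k, c = (d + k)%N by exists (c - d)%N; lia.
have [j ej] : exists j, b = (a + j.+1)%N by exists (b - a.+1)%N; lia.
by subst b c; congr pair; nia.
Qed.

Lemma path_sum_den_tmed t : reached t ->
    path_sum (lft t) (1, 1)%N = qden (lft t) ->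
    path_sum (rgt t) (1, 1)%N = qden (rgt t) ->
  path_sum (tmed t) (1, 1)%N = qden (tmed t).
Proof.
move=> rt el er; have [e|ne] := eqVneq (tmed t) (1, 1)%N; last first.
  by rewrite path_sum_tmed // qden_tmed // el er.
by rewrite e path_sum_low // /qden (qp_11 farey_q_weighting).
Qed.

Lemma path_sum_den t : reached t -> ((lft t).2 <= (lft t).1)%N ->
  path_sum (lft t) (1, 1)%N = qden (lft t) /\
  path_sum (rgt t) (1, 1)%N = qden (rgt t).
Proof.
elim=> [//|{}t rt IH|{}t rt IH] le.
  by have [el er] := IH le; split=> //; exact: path_sum_den_tmed.
have [e|/IH[el er]] := reached_tmed_ge1 rt le; last first.
  by split=> //; exact: path_sum_den_tmed.
(* The triangle with median 1/1 is the root, so its right child is the first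
   triangle to the right of 1/1, where the induction starts. *)
have rr : rgt t = (1, 0)%N.
  have := reached_rgt_lft rt; move: e; rewrite /tmed /median.
  by case: (lft t) (rgt t) => [a b] [c d] /= [e1 e2] E; congr pair; nia.
split; last by rewrite /= rr path_sum_low.
by rewrite /= e path_sum_low // /qden (qp_11 farey_q_weighting).
Qed.

(** By the subtractive Euclidean algorithm: the shears (r, s) -> (r + s, s) and
    (r, s) -> (r, r + s) keep determinants and commute with medians, so they
    map triangles to triangles. *)
Lemma coprime_median (r s : nat) : coprime r s -> (0 < r)%N -> (0 < s)%N ->
  exists u v, farey_triangle u v /\ median u v = (r, s).
Proof.
have [n] := ubnP (r + s)%N; elim: n r s => // n IH r s ltn cop r0 s0.
have [rs|sr|ers] := ltngtP r s.
- have cop' : coprime r (s - r) by rewrite /coprime -gcdnDl subnKC // ltnW.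
  have [||||[a b] [[c d] [+ [e1 e2]]]] := IH r (s - r)%N; try by lia.
  rewrite farey_triangleE => /eqP /= E; exists (a, b + a)%N, (c, d + c)%N.
  by rewrite farey_triangleE /median /=; split; [lia|congr pair; lia].
- have cop' : coprime (r - s) s.
    by rewrite coprime_sym /coprime -gcdnDl subnKC 1?gcdnC // ltnW.
  have [||||[a b] [[c d] [+ [e1 e2]]]] := IH (r - s)%N s; try by lia.
  rewrite farey_triangleE => /eqP /= E; exists (a + b, b)%N, (c + d, d)%N.
  by rewrite farey_triangleE /median /=; split; [lia|congr pair; lia].
- move: cop; rewrite ers /coprime gcdnn => /eqP ->.
  by exists (0, 1)%N, (1, 0)%N.
Qed.

Theorem theorem1 (r s : nat) (hrs : coprime r s) (hs : (0 < s)%N)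
    (hgt1 : (s < r)%N) :
  qnum (r, s) = \sum_(p \in farey_paths (r, s) (1, 0)%N) path_wt (r, s) p /\
  qden (r, s) = \sum_(p \in farey_paths (r, s) (1, 1)%N) path_wt (r, s) p.
Proof.
have [u [v [/farey_triangle_reached[t [rt lu rv]] e]]] :=
  coprime_median hrs (ltn_trans hs hgt1) hs.
rewrite -lu -rv -/(tmed t) in e; rewrite -!/(path_sum _ _) -e; split.
  by have [el er] := path_sum_num rt; rewrite path_sum_num_tmed.
have [||le] := reached_tmed_ge1 rt; first by rewrite e ltnW.
  by rewrite e => -[er es]; rewrite er es in hgt1.
by have [el er] := path_sum_den rt le; rewrite path_sum_den_tmed.
Qed.
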